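(* Let $M$ be a connected $s$-formal manifold. Let $t\ge 3$ and suppose that there are cohomology classes $\alpha_i\in H^{p_i}(M)$, $p_i>0$, $1\le i\le t$, such that the Massey product $\langle\alpha_1,\alpha_2,\dots,\alpha_t\rangle$ is defined. If $p_1+p_2+\cdots+p_{t-1}\le s+t-2$ and $p_2+\cdots+p_t\le s+t-2$, then $\langle\alpha_1,\alpha_2,\dots,\alpha_t\rangle$ vanishes.
   Context: All algebras are over $\mathbb{R}$; $H^*(M)$ is de Rham cohomology. A differential algebra is a graded commutative algebra with a differential $d$ that is a derivation. It is minimal if it is the free graded commutative algebra $\bigwedge V$ on a graded vector space $V=\bigoplus_{i>0} V^i$ and it has generators $\{a_\tau\}_{\tau\in I}$, $I$ well ordered, such that $\deg(a_\mu)\le \deg(a_\tau)$ if $\mu<\tau$ and each $da_\tau$ is expressed in terms of the preceding $a_\mu$. A minimal model of a connected manifold $M$ is a minimal differential algebra $(\bigwedge V,d)$ with a morphism to the de Rham complex $(\Omega M,d)$ inducing an isomorphism on cohomology; it is unique up to isomorphism. For $s\ge 0$, $M$ is $s$-formal if its minimal model can be written as $\bigwedge V$ such that for each $i\le s$ one has $V^i=C^i\oplus N^i$ with: (1) $d(C^i)=0$; (2) $d\colon N^i\to\bigwedge V$ is injective; (3) any closed element in the ideal generated by $\bigoplus_{i\le s}N^i$ in $\bigwedge(\bigoplus_{i\le s}V^i)$ is exact in $\bigwedge V$. Massey products: let $[a_i]\in H^{p_i}(\bigwedge V)$ correspond to $\alpha_i$ under $H^*(\bigwedge V)\cong H^*(M)$.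 The Massey product $\langle\alpha_1,\dots,\alpha_t\rangle$ is defined if there are elements $a_{i,j}\in\bigwedge V$, $1\le i\le j\le t$, $(i,j)\ne(1,t)$, such that $a_{i,i}$ is a cocycle representing $[a_i]$ and $d\,a_{i,j}=\sum_{k=i}^{j-1}\bar a_{i,k}\cdot a_{k+1,j}$ for $i<j$, where $\bar a=(-1)^{\deg a}a$. The Massey product is then the set of all cohomology classes, of degree $p_1+\cdots+p_t-(t-2)$, represented by $\sum_{k=1}^{t-1}\bar a_{1,k}\cdot a_{k+1,t}$ for such choices. It vanishes if one of these representatives is exact (i.e. the set contains $0$). *)

(* Defs.v *)
From HB Require Import structures.
From mathcomp Require Import all_boot all_order all_algebra all_fingroup.
From mathcomp Require Import all_classical all_reals all_analysis.
#[warning="-warn-library-file-internal-wochoice"]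
From mathcomp Require Import wochoice.

Set Implicit Arguments.
Unset Strict Implicit.
Unset Printing Implicit Defensive.

Import GRing.Theory numFieldNormedType.Exports.
Local Open Scope classical_set_scope.
Local Open Scope ring_scope.

(** ** Smooth manifolds (Hausdorff, second countable, without boundary) *)

Section Smooth.
Context {R : realType} {n : nat}.

Fixpoint class_C (r : nat) (U : set 'rV[R]_n) (f : 'rV[R]_n -> R) : Prop :=
  (forall x, U x -> {for x, continuous f}) /\
  match r with
  | 0 => True
  | r'.+1 => forall i : 'I_n,
      (forall x, U x -> derivable f x (delta_mx 0 i)) /\
      class_C r' U ('D_(delta_mx 0 i) f)
  end.

(* Only used for open U. *)
Definition smooth_on (U : set 'rV[R]_n) (f : 'rV[R]_n -> R) : Prop :=
  forall r, class_C r U f.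

End Smooth.

(* [atlas] is the index set of the charts; [chart_map c] and [chart_inv c] are
   total functions, meaningful only on [chart_dom c] and on its image. *)
Record manifold (R : realType) := Manifold {
  mpoint :> topologicalType;
  mdim : nat;
  mhausdorff : hausdorff_space mpoint;
  msecond_countable : @second_countable mpoint;
  atlas : Type;
  chart_dom : atlas -> set mpoint;
  chart_map : atlas -> mpoint -> 'rV[R]_mdim;
  chart_inv : atlas -> 'rV[R]_mdim -> mpoint;
  chart_dom_open : forall c, open (chart_dom c);
  chart_dom_cover : forall x, exists c, chart_dom c x;
  chart_img_open : forall c, open (chart_map c @` chart_dom c);
  chart_invK : forall c x, chart_dom c x -> chart_inv c (chart_map c x) = x;
  chart_map_continuous : forall c x, chart_dom c x ->
    {for x, continuous (chart_map c)};
  chart_inv_continuous : forall c y, (chart_map c @` chart_dom c) y ->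
    {for y, continuous (chart_inv c)};
  transition_smooth : forall c c' (j : 'I_mdim),
    smooth_on (chart_map c @` (chart_dom c `&` chart_dom c'))
              (fun y => chart_map c' (chart_inv c y) 0 j)
}.

(** ** The de Rham complex *)

Section DeRham.
Context {R : realType}.
Variable M : manifold R.
Notation n := (mdim M).

Definition chart_img (c : atlas M) : set 'rV[R]_n := chart_map c @` chart_dom c.

(* The rows of a k x n matrix are the k tangent vector arguments. *)
Definition multilinear k (f : 'M[R]_(k, n) -> R) : Prop :=
  forall (i : 'I_k) (b c : R) (A B C : 'M[R]_(k, n)),
    row i A = b *: row i B + c *: row i C ->
    row' i B = row' i A -> row' i C = row' i A ->
    f A = b * f B + c * f C.

Definition alternating k (f : 'M[R]_(k, n) -> R) : Prop :=
  forall (i j : 'I_k) (A : 'M[R]_(k, n)),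
    i != j -> row i A = row j A -> f A = 0.

(* The local expressions of a k-form in all the charts. *)
Definition dform (k : nat) := atlas M -> 'rV[R]_n -> 'M[R]_(k, n) -> R.

(* The last clause says that the local expressions correspond under pullback by
   the transition maps; the second one makes equality of forms Leibniz. *)
Definition Omega (k : nat) : set (dform k) := [set w |
  [/\ forall c x, chart_img c x -> multilinear (w c x) /\ alternating (w c x),
      forall c x A, ~ chart_img c x -> w c x A = 0,
      forall c A, smooth_on (chart_img c) (fun x => w c x A) &
      forall c c' m A, chart_dom c m -> chart_dom c' m ->
        w c (chart_map c m) A =
        w c' (chart_map c' m)
          (\matrix_(i < k)
             'D_(row i A) (chart_map c' \o chart_inv c) (chart_map c m))]].

Definition form1 : dform 0 := fun c x _ => \1_(chart_img c) x.

Definition wedge_prod p q (u : dform p) (v : dform q) : dform (p + q)%N :=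
  fun c x A => (p`!%:R * q`!%:R)^-1 *
    \sum_(s : 'S_(p + q)%N) (-1) ^+ s *
      u c x (usubmx (row_perm s A)) * v c x (dsubmx (row_perm s A)).

Definition ext_d k (w : dform k) : dform k.+1 :=
  fun c x A => \1_(chart_img c) x *
    \sum_(i < k.+1) (-1) ^+ i * 'D_(row i A) (fun y => w c y (row' i A)) x.

Definition exact_form (k : nat) : set (dform k) :=
  match k with
  | 0 => [set 0]
  | k'.+1 => [set ext_d w | w in @Omega k']
  end.

Definition closed_form (k : nat) : set (dform k) :=
  [set w | Omega w /\ ext_d w = 0].

(* Cohomology classes are cosets of the exact forms. *)
Definition form_class k (w : dform k) : set (dform k) :=
  [set w' | closed_form w' /\ exact_form (w' - w)].

Definition HdR (k : nat) : set (set (dform k)) :=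
  [set form_class w | w in @closed_form k].

End DeRham.

(** ** Graded commutative algebras *)

Definition is_subspace (R : realType) (E : lmodType R) (S : set E) : Prop :=
  S 0 /\ forall (c : R) x y, S x -> S y -> S (c *: x + y).

Record gcAlg (R : realType) := GcAlg {
  gca_alg :> algType R;
  gr : nat -> set gca_alg;
  gr_subspace : forall k, is_subspace (gr k);
  gr_span : forall x, exists (m : nat) (f : nat -> gca_alg),
    (forall k, gr k (f k)) /\ x = \sum_(0 <= k < m) f k;
  gr_direct : forall (m : nat) (f : nat -> gca_alg), (forall k, gr k (f k)) ->
    \sum_(0 <= k < m) f k = 0 -> forall k, (k < m)%N -> f k = 0;
  gr_one : gr 0%N 1;
  gr_mul : forall p q x y, gr p x -> gr q y -> gr (p + q)%N (x * y);
  gr_comm : forall p q x y, gr p x -> gr q y ->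
    x * y = (-1) ^+ (p * q)%N *: (y * x)
}.

Record dga (R : realType) := Dga {
  dga_gca :> gcAlg R;
  dif : {linear dga_gca -> dga_gca};
  dif_deg : forall k x, gr k x -> gr k.+1 (dif x);
  dif_dif : forall x, dif (dif x) = 0;
  dif_mul : forall p x y, gr p x ->
    dif (x * y) = dif x * y + (-1) ^+ p *: (x * dif y)
}.

Section Algebra.
Context {R : realType}.

Definition is_subalg (A : algType R) (B : set A) : Prop :=
  [/\ is_subspace B, B 1 & forall x y, B x -> B y -> B (x * y)].

Definition subalg_gen (A : algType R) (S : set A) : set A :=
  smallest (@is_subalg A) S.

Definition is_ideal (A : algType R) (B J : set A) : Prop :=
  is_subspace J /\ forall b x, B b -> J x -> J (b * x) /\ J (x * b).

(* The ideal of the subalgebra B generated by S (for S contained in B). *)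
Definition ideal_gen (A : algType R) (B S : set A) : set A :=
  smallest (is_ideal B) S.

Definition graded_map (A B : gcAlg R) (g : A -> B) : Prop :=
  forall k x, gr k x -> gr k (g x).

Definition graded_subspace (A : gcAlg R) (V : nat -> set A) : Prop :=
  forall k, is_subspace (V k) /\ V k `<=` @gr R A k.

(* A is the free graded commutative algebra on V; f matters only on the
   homogeneous elements of V. *)
Definition free_on (A : gcAlg R) (V : nat -> set A) : Prop :=
  forall (B : gcAlg R) (f : A -> B),
    (forall k x, V k x -> gr k (f x)) ->
    (forall k (c : R) x y, V k x -> V k y -> f (c *: x + y) = c *: f x + f y) ->
    exists g : {lrmorphism A -> B},
      [/\ graded_map g, forall k x, V k x -> g x = f x &
          forall h : {lrmorphism A -> B}, graded_map h ->
            (forall k x, V k x -> h x = f x) -> h =1 g].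

Definition homogeneous_basis (A : gcAlg R) (V : nat -> set A)
    (I : eqType) (deg : I -> nat) (a : I -> A) : Prop :=
  [/\ forall i, V (deg i) (a i),
      forall (s : seq I) (c : I -> R), uniq s ->
        \sum_(i <- s) c i *: a i = 0 -> forall i, i \in s -> c i = 0 &
      forall k v, V k v -> exists (s : seq I) (c : I -> R),
        v = \sum_(i <- s) c i *: a i].

Definition minimal_on (A : dga R) (V : nat -> set A) : Prop :=
  [/\ graded_subspace V, V 0%N = [set 0], free_on V &
      exists (I : eqType) (le : rel I) (deg : I -> nat) (a : I -> A),
        [/\ well_order le, homogeneous_basis V deg a,
            forall i j, le i j -> (deg i <= deg j)%N &
            forall j, subalg_gen [set a i | i in [set i | le i j /\ i <> j]]
                        (dif A (a j))]].

Definition is_minimal (A : dga R) : Prop := exists V, @minimal_on A V.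

Definition exact_elt (A : dga R) : set A := range (dif A).

Definition alg_class (A : dga R) (k : nat) (x : A) : set A :=
  [set y | [/\ gr k y, dif A y = 0 & exact_elt (y - x)]].

(* Conditions (1)-(3) of s-formality for the minimal algebra A. *)
Definition s_formal (A : dga R) (s : nat) : Prop :=
  exists V C N : nat -> set A,
    [/\ minimal_on V,
        forall i, (i <= s)%N ->
          [/\ is_subspace (C i), is_subspace (N i),
              C i `&` N i = [set 0] &
              V i = [set x + y | x in C i & y in N i]],
        forall i x, (i <= s)%N -> C i x -> dif A x = 0,
        forall i x y, (i <= s)%N -> N i x -> N i y ->
          dif A x = dif A y -> x = y &
        forall x, ideal_gen (subalg_gen (\bigcup_(i in `I_s.+1) V i))
                            (\bigcup_(i in `I_s.+1) N i) x ->
          dif A x = 0 -> exact_elt x].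

End Algebra.

(** ** Minimal models and Massey products *)

Section Models.
Context {R : realType} {M : manifold R} {A : dga R}.
(* A graded map to the de Rham complex; [rho k] matters only in degree k. *)
Variable rho : forall k, A -> dform M k.
Arguments rho : clear implicits.

Definition dga_morphism : Prop :=
  [/\ forall k x, gr k x -> Omega (rho k x),
      forall k (c : R) x y, gr k x -> gr k y ->
        rho k (c *: x + y) = c *: rho k x + rho k y,
      rho 0%N 1 = @form1 R M,
      forall p q x y, gr p x -> gr q y ->
        rho (p + q)%N (x * y) = wedge_prod (rho p x) (rho q y) &
      forall k x, gr k x -> rho k.+1 (dif A x) = ext_d (rho k x)].

(* Injectivity, then surjectivity, of the map induced on H^k. *)
Definition cohomology_iso : Prop := forall k : nat,
  (forall x, gr k x -> dif A x = 0 -> exact_form (rho k x) -> exact_elt x) /\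
  (forall w, @closed_form R M k w -> exists x,
     [/\ gr k x, dif A x = 0 & exact_form (w - rho k x)]).

Definition minimal_model : Prop :=
  [/\ is_minimal A, dga_morphism & cohomology_iso].

Section Massey.
Variables (t : nat) (p : nat -> nat) (alpha : forall i, set (dform M (p i))).
Arguments alpha : clear implicits.

(* The degree of a_(i,j); the subtraction is exact when the p_k are positive. *)
Definition mdeg (i j : nat) : nat :=
  (\sum_(i <= k < j.+1) p k - (j - i))%N.

Definition massey_sum (a : nat -> nat -> A) (i j : nat) : A :=
  \sum_(i <= k < j) ((-1) ^+ mdeg i k *: a i k) * a k.+1 j.

(* Indices run from 1 to t; other values of p, alpha and a are irrelevant. *)
Definition defining_system (a : nat -> nat -> A) : Prop :=
  [/\ forall i j, (1 <= i <= j)%N -> (j <= t)%N -> (i, j) <> (1, t)%N ->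
        gr (mdeg i j) (a i j),
      forall i, (1 <= i <= t)%N ->
        dif A (a i i) = 0 /\ alpha i (rho (p i) (a i i)) &
      forall i j, (1 <= i < j)%N -> (j <= t)%N -> (i, j) <> (1, t)%N ->
        dif A (a i j) = massey_sum a i j].

Definition massey_defined : Prop := exists a, defining_system a.

Definition massey_degree : nat :=
  (\sum_(1 <= i < t.+1) p i - (t - 2))%N.

Definition massey_product : set (set A) :=
  [set alg_class massey_degree (massey_sum a 1 t) | a in defining_system].

Definition massey_vanishes : Prop := massey_product (alg_class massey_degree 0).

End Massey.
End Models.

(* Main.v *)
(* The elements a_{i,j} of a defining system have degree at most s, so they lie
   in the subalgebra B generated by the V^i, i <= s, which is freeness of A
   applied to a graded subalgebra. Modulo the ideal I of B generated by the N^i,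
   every element of B is closed. Keep the diagonal a_{i,i}, and replace
   a_{i,i+1} by its component in I, which has the same differential. By
   induction on j - i, the sum prescribed for d a_{i,j} is then a closed element
   of I, hence exact by s-formality, and it has a primitive in I. As t >= 3, the
   last sum, the representative of the Massey product, is exact as well. *)
From HB Require Import structures.
Require Import Defs.
From mathcomp Require Import all_boot all_order all_algebra.
From mathcomp Require Import all_classical all_reals all_analysis.
From mathcomp Require Import zify.
Import GRing.Theory.
Local Open Scope classical_set_scope.

Local Open Scope ring_scope.

(** * Subspaces, generated subalgebras and generated ideals *)

Lemma subspace_sum (R : realType) (E : lmodType R) (S : set E) (I : eqType)
    (r : seq I) (P : pred I) (f : I -> E) :
  is_subspace S -> (forall i, i \in r -> P i -> S (f i)) ->
  S (\sum_(i <- r | P i) f i).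
Proof.
move=> [S0 SD]; elim: r => [_|i r IH Sf]; first by rewrite big_nil.
have Sr : S (\sum_(i <- r | P i) f i).
  by apply: IH => j jr; apply: Sf; rewrite inE jr orbT.
rewrite big_cons; case: ifPn => // Pi.
by rewrite -[f i]scale1r; apply: SD => //; apply: Sf => //; rewrite mem_head.
Qed.

Lemma subspaceD {R : realType} {E : lmodType R} {S : set E} {x y : E} :
  is_subspace S -> S x -> S y -> S (x + y).
Proof. by move=> [_ SD] Sx Sy; rewrite -[x]scale1r; apply: SD. Qed.

Lemma subspaceZ {R : realType} {E : lmodType R} {S : set E} (c : R) {x : E} :
  is_subspace S -> S x -> S (c *: x).
Proof. by move=> [S0 SD] Sx; rewrite -[_ *: _]addr0; apply: SD. Qed.

Lemma subspaceB {R : realType} {E : lmodType R} {S : set E} {x y : E} :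
  is_subspace S -> S x -> S y -> S (x - y).
Proof.
by move=> sS Sx Sy; rewrite -scaleN1r; apply: subspaceD => //; apply: subspaceZ.
Qed.

Lemma subalg_genP {R : realType} {A : algType R} (S : set A) :
  is_subalg (subalg_gen S).
Proof.
split; first split.
- by move=> T [[[]]].
- by move=> c x y Sx Sy T TS; have [[[_ +] _ _] _] := TS; apply;
    [apply: Sx|apply: Sy].
- by move=> T [[]].
- by move=> x y Sx Sy T TS; have [[_ _ +] _] := TS; apply;
    [apply: Sx|apply: Sy].
Qed.

Lemma ideal_genP {R : realType} {A : algType R} (B S : set A) :
  is_ideal B (ideal_gen B S).
Proof.
split; first split.
- by move=> T [[[]]].
- by move=> c x y Sx Sy T TS; have [[[_ +] _] _] := TS; apply;
    [apply: Sx|apply: Sy].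
- by move=> b x Bb Jx; split=> T TS; have [[_ TM] _] := TS;
    have [] := TM b x Bb (Jx T TS).
Qed.

(** * Sums of graded families of subspaces *)

Section GradedSpan.
Context {R : realType} {A : gcAlg R}.

Definition graded_span (S : nat -> set A) : set A :=
  [set x | exists m f, (forall k, S k (f k)) /\ x = \sum_(0 <= k < m) f k].

Variable S : nat -> set A.
Hypothesis S_sub : graded_subspace S.

(** Padding with zeros makes the length arbitrary, so that two decompositions can be brought to a
    common length. *)
Lemma graded_spanP x : graded_span S x ->
  exists m f, (forall k, S k (f k)) /\
    forall n, (m <= n)%N -> x = \sum_(0 <= k < n) f k.
Proof.
move=> [m [f [Sf ->]]].
exists m, (fun k => if (k < m)%N then f k else 0); split.
  by move=> k; case: ifP => // _; case: (S_sub k) => [[]].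
move=> n mn; rewrite [RHS](big_cat_nat _ mn) //= [X in _ + X]big_nat_cond.
rewrite [X in _ + X]big1 ?addr0; last first.
  by move=> k /andP[/andP[mk _] _]; rewrite ltnNge mk.
by apply: eq_big_nat => k /andP[_ ->].
Qed.

Lemma graded_span_subspace : is_subspace (graded_span S).
Proof.
split; first by exists 0%N, (fun=> 0); rewrite big_geq //; split=> // k;
  case: (S_sub k) => [[]].
move=> c x y /graded_spanP[m [f [Sf fE]]] /graded_spanP[n [g [Sg gE]]].
exists (maxn m n), (fun k => c *: f k + g k); split.
  by move=> k; case: (S_sub k) => [[_ +] _]; apply.
by rewrite big_split -scaler_sumr /= -fE ?leq_maxl// -gE// leq_maxr.
Qed.

Lemma sub_graded_span k : S k `<=` graded_span S.
Proof.
move=> x Sx; exists k.+1, (fun l => if l == k then x else 0); split.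
  by move=> l; case: eqP => [->//|_]; case: (S_sub l) => [[]].
rewrite big_nat_recr //= eqxx big_nat_cond big1 ?add0r// => l.
by rewrite andbT => /ltn_eqF ->.
Qed.

(** Homogeneous components are unique: subtracting [x] from the component of degree [k] leaves a
    vanishing sum, to which [gr_direct] applies. This is how a property is read off once it has been
    extended to sums. *)
Lemma graded_span_gr k x : graded_span S x -> gr k x -> S k x.
Proof.
move=> /graded_spanP[m [f [Sf fE]]] grx.
pose n := maxn m k.+1.
have kn : (k < n)%N by rewrite /n leq_maxr.
pose g l := f l - (if l == k then x else 0).
have gg l : gr l (g l).
  apply: subspaceB; [exact: gr_subspace|by apply: (S_sub l).2|].
  by case: eqP => [->//|_]; case: (gr_subspace A l).
have /(gr_direct gg)/(_ k kn) : \sum_(0 <= l < n) g l = 0.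
  rewrite sumrB -fE ?leq_maxl// -big_mkcond /= big_nat1_eq /=.
  by rewrite kn subrr.
by rewrite /g eqxx => /eqP; rewrite subr_eq0 => /eqP <-.
Qed.

Lemma graded_span_subalg :
  S 0%N 1 -> (forall p q x y, S p x -> S q y -> S (p + q)%N (x * y)) ->
  is_subalg (graded_span S).
Proof.
move=> S1 SM; split; first exact: graded_span_subspace.
  exact: (@sub_graded_span 0%N).
move=> _ _ [m [f [Sf ->]]] [n [g [Sg ->]]].
rewrite mulr_suml; apply: subspace_sum => [|k _ _].
  exact: graded_span_subspace.
rewrite mulr_sumr; apply: subspace_sum => [|l _ _].
  exact: graded_span_subspace.
by apply: (@sub_graded_span (k + l)%N); apply: SM.
Qed.

End GradedSpan.

(** * Subalgebras as algebras in their own right *)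

Section SubAlgebra.
Context {R : realType} {A : algType R}.
Variables (P : set A) (P_alg : is_subalg P).

Definition subalg_pred of is_subalg P : {pred A} := fun x => `[< P x >].

Fact subalg_pred_closed : GRing.subalg_closed (subalg_pred P_alg).
Proof.
case: (P_alg) => -[P0 PD] P1 PM; split; first exact/asboolP.
  by move=> c x y /asboolP Px /asboolP Py; apply/asboolP; apply: PD.
by move=> x y /asboolP Px /asboolP Py; apply/asboolP; apply: PM.
Qed.

HB.instance Definition _ :=
  GRing.isSubalgClosed.Build R A (subalg_pred P_alg) subalg_pred_closed.

Record subalg_of := SubAlgOf
  { subalg_val : A; _ : subalg_val \in subalg_pred P_alg }.

HB.instance Definition _ := [isSub for subalg_val].
HB.instance Definition _ := [Choice of subalg_of by <:].
HB.instance Definition _ := [SubChoice_isSubAlgebra of subalg_of by <:].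

(* [val] has linear and ring morphism structures but no joint one. *)
Definition subalg_incl (x : subalg_of) : A := val x.

Fact subalg_incl_linear : linear subalg_incl.
Proof. by move=> c x y; apply: (linearP (val : subalg_of -> A)). Qed.

Fact subalg_incl_monoid_morphism : monoid_morphism subalg_incl.
Proof.
split; first exact: (rmorph1 (val : subalg_of -> A)).
by move=> x y; apply: (rmorphM (val : subalg_of -> A)).
Qed.

HB.instance Definition _ :=
  GRing.isLinear.Build R subalg_of A *:%R subalg_incl subalg_incl_linear.
HB.instance Definition _ :=
  GRing.isMonoidMorphism.Build subalg_of A subalg_incl subalg_incl_monoid_morphism.

End SubAlgebra.

(** * Graded subalgebras that contain free generators *)

Section FreeGenerated.
Context {R : realType} {A : gcAlg R}.
Variable S : nat -> set A.
Hypothesis S_sub : graded_subspace S.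
Hypothesis S_one : S 0%N 1.
Hypothesis S_mul : forall p q x y, S p x -> S q y -> S (p + q)%N (x * y).

Let P_alg : is_subalg (graded_span S) := graded_span_subalg S S_sub S_one S_mul.
Let U := subalg_of _ P_alg.
Let sub_gr k : set U := [set u | gr k (val u)].

Let UP (u : U) : graded_span S (val u).
Proof. by have /asboolP := valP u. Qed.

Let to_U (x : A) : U := insubd 0 x.

Let to_UK x : graded_span S x -> val (to_U x) = x.
Proof. by move=> Sx; rewrite insubdK //; apply/asboolP. Qed.

Let val_sumU (m : nat) (f : nat -> U) :
  val (\sum_(0 <= k < m) f k) = \sum_(0 <= k < m) val (f k).
Proof. exact: raddf_sum. Qed.

Fact subalg_gr_subspace k : is_subspace (sub_gr k).
Proof.
have [g0 gD] := gr_subspace A k.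
split=> [|c x y gx gy]; first by rewrite /sub_gr /mkset raddf0.
by rewrite /sub_gr /mkset linearP; apply: gD.
Qed.

Fact subalg_gr_span (x : U) : exists (m : nat) (f : nat -> U),
    (forall k, sub_gr k (f k)) /\ x = \sum_(0 <= k < m) f k.
Proof.
have [m [f [Sf xE]]] := UP x.
have fP k : graded_span S (f k) by apply: sub_graded_span (Sf k).
exists m, (fun k => to_U (f k)); split.
  by move=> k; rewrite /sub_gr /= to_UK//; apply: (S_sub k).2.
apply: val_inj; rewrite val_sumU xE; apply: eq_bigr => k _.
by rewrite to_UK.
Qed.

Fact subalg_gr_direct (m : nat) (f : nat -> U) : (forall k, sub_gr k (f k)) ->
    \sum_(0 <= k < m) f k = 0 -> forall k, (k < m)%N -> f k = 0.
Proof.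
move=> gf f0 k km; apply: val_inj; rewrite raddf0.
apply: (gr_direct (f := fun k => val (f k)) gf _ km).
by rewrite -val_sumU f0 raddf0.
Qed.

Fact subalg_gr_one : sub_gr 0%N 1.
Proof. by rewrite /sub_gr /mkset rmorph1; apply: gr_one. Qed.

Fact subalg_gr_mul p q (x y : U) : sub_gr p x -> sub_gr q y -> sub_gr (p + q)%N (x * y).
Proof. by rewrite /sub_gr /mkset rmorphM; apply: gr_mul. Qed.

Fact subalg_gr_comm p q (x y : U) : sub_gr p x -> sub_gr q y ->
  x * y = (-1) ^+ (p * q)%N *: (y * x).
Proof.
move=> gx gy; apply: val_inj; rewrite linearZ !rmorphM.
exact: gr_comm.
Qed.

Let Ualg : gcAlg R :=
  GcAlg subalg_gr_subspace subalg_gr_span subalg_gr_direct subalg_gr_one subalg_gr_mul subalg_gr_comm.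

(* Uniqueness in the universal property: the retraction of [A] onto a graded
   subalgebra containing the generators, followed by the inclusion, is [id]. *)
Lemma free_on_generated (V : nat -> set A) :
  free_on V -> (forall k, V k `<=` S k) -> forall x, graded_span S x.
Proof.
move=> freeV VS x.
have VP k v : V k v -> graded_span S v.
  by move=> Vv; apply: (@sub_graded_span _ _ S S_sub k); apply: VS.
have Vgr k v : V k v -> gr k v by move=> /VS; apply: (S_sub k).2.
have PD c v w : graded_span S v -> graded_span S w -> graded_span S (c *: v + w).
  by have [_] := graded_span_subspace S S_sub; apply.
have [||g [gg gV _]] := freeV Ualg to_U.
- by move=> k v Vv; rewrite /= /sub_gr /= to_UK; [apply: Vgr|apply: VP Vv].
- move=> k c v w /VP Vv /VP Vw; apply: val_inj.
  by rewrite linearP /= !to_UK//; apply: PD.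
(* Both [e] and the identity extend the inclusion of [V] into [A], hence both equal [h]. *)
have [//|//|h [_ _ huniq]] := freeV A id.
pose e := GRing.LRMorphism.clone _ _ _ _
  ((@subalg_incl _ _ _ P_alg : Ualg -> A) \o g) _.
have eh : e =1 h.
  apply: huniq => [k v /gg //|k v Vv].
  rewrite /= /subalg_incl (gV k v Vv); exact: to_UK (VP _ _ Vv).
have ih : idfun =1 h by apply: (huniq [the {lrmorphism A -> A} of idfun]).
by rewrite -[x]/(idfun x) ih -eh /=; apply: UP.
Qed.

End FreeGenerated.

(** * Primitives and low-degree elements in differential algebras *)

Section DgaFacts.
Context {R : realType} {A : dga R}.

Lemma dif1 : dif A 1 = 0.
Proof.
have := dif_mul (1 : A) (gr_one A).
rewrite !mulr1 mul1r expr0 scale1r => /eqP.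
by rewrite eq_sym -subr_eq0 addrK => /eqP.
Qed.

Lemma dif_mul_closed p (x y : A) : gr p x -> dif A x = 0 -> dif A y = 0 ->
  dif A (x * y) = 0.
Proof. by move=> gx x0 y0; rewrite (dif_mul _ gx) x0 y0 mul0r mulr0 scaler0 addr0. Qed.

(** An arbitrary primitive may be inhomogeneous; the differential of its component of degree [k] is
    the component of [x] of degree [k.+1], which is [x] itself. *)
Lemma exact_gr k (x : A) : gr k.+1 x -> exact_elt x ->
  exists2 z, gr k z & dif A z = x.
Proof.
move=> gx [z _ xE].
pose S l : set A := if l is m.+1 then [set dif A u | u in gr m] else [set 0].
have S_sub : graded_subspace S.
  move=> [|l]; split.
  - by split=> // c u v -> ->; rewrite scaler0 addr0.
  - by move=> _ ->; case: (gr_subspace A 0).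
  - have [g0 gD] := gr_subspace A l; split; first by exists 0 => //; rewrite linear0.
    move=> c _ _ [u gu <-] [v gv <-].
    by exists (c *: u + v); [apply: gD|rewrite linearP].
  - by move=> _ [u gu <-]; apply: dif_deg.
suff /(graded_span_gr S S_sub)/(_ gx) [u gu uE] : graded_span S x by exists u.
have [m [f [gf zE]]] := gr_span z.
rewrite -xE zE linear_sum; apply: subspace_sum => [|l _ _].
  exact: graded_span_subspace.
by apply: (@sub_graded_span _ _ S S_sub l.+1); exists (f l).
Qed.

(** Degrees are nonnegative, so a product of degree at most [s] has both factors of degree at most
    [s]. Generators of larger degree therefore cannot contribute. *)
Lemma free_low_degree (V : nat -> set A) (s k : nat) (x : A) :
  graded_subspace V -> free_on V -> (k <= s)%N -> gr k x ->
  subalg_gen (\bigcup_(i in `I_s.+1) V i) x.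
Proof.
move=> V_sub freeV ks gx.
set B := subalg_gen _.
have [B_sub B1 BM] : is_subalg B by apply: subalg_genP.
(* Above degree [s] the condition is vacuous, which lets [S] contain every generator. *)
pose S l : set A := [set y | gr l y /\ ((l <= s)%N -> B y)].
have S_sub : graded_subspace S.
  move=> l; split=> [|y []//]; have [g0 gD] := gr_subspace A l.
  split; first by split=> // _; case: B_sub.
  move=> c u v [gu Bu] [gv Bv]; split; first exact: gD.
  by move=> ls; apply: B_sub.2; [apply: Bu|apply: Bv].
suff /(graded_span_gr S S_sub)/(_ gx) [_ ] : graded_span S x by apply.
apply: (free_on_generated S S_sub _ _ V freeV).
- by split=> //; apply: gr_one.
- move=> p q u v [gu Bu] [gv Bv]; split; first exact: gr_mul.
  move=> pqs; apply: BM; [apply: Bu|apply: Bv].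
    exact: leq_trans (leq_addr _ _) pqs.
  exact: leq_trans (leq_addl _ _) pqs.
- move=> l v Vv; split; first exact: (V_sub l).2.
  by move=> ls T [_ TV]; apply: TV; exists l.
Qed.

(* Modulo closed elements, the subalgebra generated by the [C i + N i] is
   contained in the ideal generated by the [N i]. *)
Lemma ideal_primitive (V C N : nat -> set A) (s k : nat) (x : A) :
  let B := subalg_gen (\bigcup_(i in `I_s.+1) V i) in
  graded_subspace V ->
  (forall i, (i <= s)%N -> [/\ is_subspace (C i), is_subspace (N i) &
    V i = [set x + y | x in C i & y in N i]]) ->
  (forall i x, (i <= s)%N -> C i x -> dif A x = 0) ->
  B x -> gr k x ->
  exists y, [/\ ideal_gen B (\bigcup_(i in `I_s.+1) N i) y, gr k y &
    dif A y = dif A x].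
Proof.
move=> B V_sub VCN dC Bx gx.
have [B_sub B1 BM] : is_subalg B by apply: subalg_genP.
set J := ideal_gen _ _.
have [J_sub JM] : is_ideal B J by apply: ideal_genP.
(* The closed part [c] is kept homogeneous for the Leibniz rule, and in [B] so that multiplying by
   it preserves [J]. *)
pose S l : set A := [set u | [/\ gr l u, B u & exists c,
  [/\ gr l c, B c, dif A c = 0 & J (u - c)]]].
have S_sub : graded_subspace S.
  move=> l; split=> [|y []//]; have [g0 gD] := gr_subspace A l.
  split.
    split=> //; first by case: B_sub.
    exists 0; split=> //; first by case: B_sub.
      exact: linear0.
    by rewrite subrr; case: J_sub.
  move=> e u v [gu Bu [c [gc Bc c0 Jc]]] [gv Bv [d [gd Bd d0 Jd]]].
  split; [exact: gD|exact: B_sub.2|].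
  exists (e *: c + d); split; [exact: gD|exact: B_sub.2| |].
    by rewrite linearP c0 d0 scaler0 addr0.
  by rewrite opprD addrACA -scalerBr; apply: J_sub.2.
have S_alg : is_subalg (graded_span S).
  apply: graded_span_subalg => //.
    split=> //; first exact: gr_one.
    exists 1; split=> //; [exact: gr_one|exact: dif1|].
    by rewrite subrr; case: J_sub.
  move=> p q u v [gu Bu [c [gc Bc c0 Jc]]] [gv Bv [d [gd Bd d0 Jd]]].
  split; [exact: gr_mul|exact: BM|].
  exists (c * d); split; [exact: gr_mul|exact: BM| |].
    exact: dif_mul_closed gc c0 d0.
  have -> : u * v - c * d = u * (v - d) + (u - c) * d.
    by rewrite mulrBr mulrBl addrA subrK.
  by apply: (subspaceD J_sub); [exact: (JM u _ Bu Jd).1|exact: (JM d _ Bd Jc).2].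
have VS i v : (i <= s)%N -> V i v -> S i v.
  move=> si Vv; have [Csub Nsub VE] := VCN i si.
  have BV w : V i w -> B w by move=> Vw T [_ TV]; apply: TV; exists i.
  (* Since [0] lies in [N i], the closed summand itself lies in [V i]; this gives its degree. *)
  have CV c : C i c -> V i c.
    by move=> Cc; rewrite VE; exists c => //; exists 0; [case: Nsub|rewrite addr0].
  split; [exact: (V_sub i).2|exact: BV|].
  move: Vv; rewrite VE => -[c Cc [n Nn <-]]; exists c; split.
  - by apply: (V_sub i).2; apply: CV.
  - by apply: BV; apply: CV.
  - exact: dC Cc.
  - by rewrite addrAC subrr add0r => T [_ TN]; apply: TN; exists i.
have BS : B `<=` graded_span S.
  move=> u Bu; apply: Bu; split=> // v [i si Vv].
  by apply: (@sub_graded_span _ _ S S_sub i); apply: VS.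
have [_ _ [c [gc _ c0 Jc]]] := graded_span_gr S S_sub k x (BS x Bx) gx.
exists (x - c); split=> //; first exact: subspaceB (gr_subspace A k) gx gc.
by rewrite linearB /= c0 subr0.
Qed.

End DgaFacts.

(** * Degrees, signs and closedness of Massey sums *)

Section DefiningSystems.
Context {R : realType} {A : dga R}.
Variables (t : nat) (p : nat -> nat).
Hypothesis p_gt0 : forall i, (1 <= i <= t)%N -> (0 < p i)%N.

(** This makes the truncated subtraction in [mdeg] exact, and [mdeg] positive on nonempty
    intervals. *)
Lemma sum_gt0_ge (i j : nat) : (1 <= i)%N -> (j <= t)%N ->
  (j.+1 - i <= \sum_(i <= k < j.+1) p k)%N.
Proof.
move=> i1 jt; rewrite -[X in (X <= _)%N]muln1 -sum_nat_const_nat.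
by rewrite !big_nat; apply: leq_sum => k ijk; apply: p_gt0; lia.
Qed.

(** The two pieces have lengths adding up to [j - i - 1], one less than is subtracted for the whole
    interval; hence the successor. *)
Lemma mdeg_split (i k j : nat) : (1 <= i <= k)%N -> (k < j <= t)%N ->
  (mdeg p i k + mdeg p k.+1 j = (mdeg p i j).+1)%N.
Proof.
move=> ik kj; rewrite /mdeg (big_cat_nat (n := k.+1) (m := i) (p := j.+1)) /=; [|lia|lia].
have := sum_gt0_ge i k ltac:(lia) ltac:(lia).
have := sum_gt0_ge k.+1 j ltac:(lia) ltac:(lia); lia.
Qed.

(** Each end is moved in turn: by [mdeg_split], cutting off a nonempty piece lowers the degree by
    that of the piece minus one, which is nonnegative. *)
Lemma mdeg_le (i' j' i j : nat) : (1 <= i')%N -> (i' <= i <= j)%N ->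
  (j <= j' <= t)%N -> (mdeg p i j <= mdeg p i' j')%N.
Proof.
move=> i1 ij jj'; apply: (@leq_trans (mdeg p i j')).
  have [->//|jj] := eqVneq j j'.
  have := mdeg_split i j j' ltac:(lia) ltac:(lia).
  have := sum_gt0_ge j.+1 j' ltac:(lia) ltac:(lia); rewrite /mdeg; lia.
have [->//|ii] := eqVneq i i'.
have := mdeg_split i' i.-1 j' ltac:(lia) ltac:(lia).
have := sum_gt0_ge i' i.-1 ltac:(lia) ltac:(lia).
have -> : i.-1.+1 = i by lia.
rewrite /mdeg; have -> : i.-1.+1 = i by lia.
lia.
Qed.

Lemma massey_sum_gr (a : nat -> nat -> A) (i j : nat) :
  (1 <= i)%N -> (j <= t)%N ->
  (forall k, (i <= k < j)%N ->
    gr (mdeg p i k) (a i k) /\ gr (mdeg p k.+1 j) (a k.+1 j)) ->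
  gr (mdeg p i j).+1 (massey_sum p a i j).
Proof.
move=> i1 jt ga; apply: subspace_sum => [|k]; first exact: gr_subspace.
rewrite mem_index_iota => ikj _; have [gik gkj] := ga k ikj.
rewrite -(mdeg_split i k j); [|lia|lia].
by apply: gr_mul => //; apply: subspaceZ => //; apply: gr_subspace.
Qed.

(** By the Leibniz rule each triple product [a i l * a l.+1 k * a k.+1 j] occurs twice, from
    differentiating the left and the right factor, with opposite signs. *)
Lemma massey_sum_closed (a : nat -> nat -> A) (i j : nat) :
  (1 <= i)%N -> (j <= t)%N ->
  (forall k l, (i <= k <= l)%N -> (l <= j)%N -> (i < k)%N || (l < j)%N ->
    gr (mdeg p k l) (a k l) /\ dif A (a k l) = massey_sum p a k l) ->
  dif A (massey_sum p a i j) = 0.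
Proof.
move=> i1 jt Ha.
pose sg k l : R := (-1) ^+ mdeg p k l.
(* Only the sign of the middle factor survives: on the right the two outer signs square to one, and
   on the left [mdeg_split] gives its opposite. *)
pose T l k : A := sg l.+1 k *: (a i l * a l.+1 k * a k.+1 j).
have -> : dif A (massey_sum p a i j) =
    \sum_(i <= k < j) (- (\sum_(i <= l < j | (l < k)%N) T l k) +
                       \sum_(i <= l < j | (k < l)%N) T k l).
  rewrite linear_sum; apply: eq_big_nat => k ikj.
  have [gik dik] : gr (mdeg p i k) (a i k) /\ dif A (a i k) = massey_sum p a i k.
    by apply: Ha; lia.
  have [gkj dkj] : gr (mdeg p k.+1 j) (a k.+1 j) /\
      dif A (a k.+1 j) = massey_sum p a k.+1 j.
    by apply: Ha; lia.
  rewrite (dif_mul _ (subspaceZ _ (gr_subspace A _) gik)) linearZ /=.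
  rewrite -!scalerAl scalerA -expr2 sqrr_sign scale1r dik dkj.
  congr (_ + _).
    rewrite mulr_suml scaler_sumr -sumrN.
    (* Both inner sums are widened to the range from [i] to [j] with a side condition, so that
       exchanging the order of summation turns one double sum into the other. *)
    rewrite [LHS](big_nat_widen _ _ j); last lia.
    rewrite big_nat_cond [RHS]big_nat_cond; apply: eq_big => l //.
    move=> /andP[ilj /= lk].
    rewrite -!scalerAl scalerA -scaleNr; congr (_ *: _).
    have mdegE := mdeg_split i l k ltac:(lia) ltac:(lia).
    rewrite /sg -exprD -[RHS]mulN1r -exprS.
    rewrite -[LHS]signr_odd -[RHS]signr_odd; congr (_ ^+ nat_of_bool _); lia.
  rewrite mulr_sumr [LHS](big_nat_widenl _ i); last lia.
  rewrite big_nat_cond [RHS]big_nat_cond; apply: eq_big => l; first lia.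
  by move=> _; rewrite -scalerAl -scalerAr mulrA.
rewrite big_split sumrN /= (exchange_big_dep_nat predT) //=.
by rewrite addrC subrr.
Qed.

(** * Moving a defining system into the ideal *)

Section Formality.
Variables (B I : set A) (s : nat).
Hypothesis B_alg : is_subalg B.
Hypothesis I_ideal : is_ideal B I.
Hypothesis B_low : forall k x, (k <= s)%N -> gr k x -> B x.
Hypothesis I_primitive : forall k x, (k <= s)%N -> gr k x ->
  exists y, [/\ I y, gr k y & dif A y = dif A x].
Hypothesis I_exact : forall x, I x -> dif A x = 0 -> exact_elt x.
Hypothesis mdeg_low : forall i j, (1 <= i <= j)%N -> (j <= t)%N ->
  (1 < i)%N || (j < t)%N -> (mdeg p i j <= s)%N.

(** The number [n] bounds the lengths already treated. On the diagonal the Massey sum is empty, so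
    the last clause says that [a i i] is closed. *)
Definition ideal_system (a : nat -> nat -> A) (n : nat) : Prop :=
  forall i j, (1 <= i <= j)%N -> (j <= t)%N -> (1 < i)%N || (j < t)%N ->
    (j - i <= n)%N ->
    [/\ gr (mdeg p i j) (a i j), (i < j)%N -> I (a i j) &
        dif A (a i j) = massey_sum p a i j].

(** Only entries of length [n.+1] change, and a Massey sum of length at most [n.+1] involves
    strictly shorter entries, so the equations already solved persist. *)
Lemma ideal_system_extend (a : nat -> nat -> A) (n : nat) :
  ideal_system a n ->
  (forall i j, (1 <= i <= j)%N -> (j <= t)%N -> (1 < i)%N || (j < t)%N ->
    (j - i = n.+1)%N ->
    exists y, [/\ I y, gr (mdeg p i j) y & dif A y = massey_sum p a i j]) ->
  exists2 a', ideal_system a' n.+1 & forall i, a' i i = a i i.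
Proof.
move=> Ha ext.
(* The side conditions sit inside the existential so that [choice] ranges over all pairs, with value
   [0] at the irrelevant ones. *)
have /choice[f fP] : forall ij : nat * nat, exists y : A,
    (1 <= ij.1 <= ij.2)%N -> (ij.2 <= t)%N -> (1 < ij.1)%N || (ij.2 < t)%N ->
    (ij.2 - ij.1 = n.+1)%N ->
    [/\ I y, gr (mdeg p ij.1 ij.2) y &
        dif A y = massey_sum p a ij.1 ij.2].
  move=> [i j] /=.
  have [c|nc] := pselect [/\ (1 <= i <= j)%N, (j <= t)%N,
    (1 < i)%N || (j < t)%N & (j - i = n.+1)%N].
    by have [c1 c2 c3 c4] := c; have [y Hy] := ext i j c1 c2 c3 c4; exists y.
  by exists 0 => c1 c2 c3 c4; case: nc.
pose a' i j := if (j - i == n.+1)%N then f (i, j) else a i j.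
have a'_eq i j : (j - i <= n)%N -> a' i j = a i j.
  by rewrite /a'; case: eqP => // ->; rewrite ltnn.
have ms_eq i j : (j - i <= n.+1)%N -> massey_sum p a' i j = massey_sum p a i j.
  move=> ijn; apply: eq_big_nat => k ikj; rewrite !a'_eq //; lia.
exists a' => [i j ij jt prop ijn|i]; last by rewrite a'_eq // subnn.
rewrite ms_eq //.
have [E|ne] := eqVneq (j - i)%N n.+1.
  have [If gf df] := fP (i, j) ij jt prop E.
  by rewrite /a' E eqxx; split.
by rewrite a'_eq; [apply: Ha|]; lia.
Qed.

(** When [j - i] exceeds one, no term has two diagonal factors: one factor lies in [I], and the
    other lies in [B] by its degree. *)
Lemma massey_sum_ideal (a : nat -> nat -> A) (n i j : nat) :
  ideal_system a n -> (1 <= i)%N -> (j <= t)%N -> (1 < j - i <= n.+1)%N ->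
  I (massey_sum p a i j).
Proof.
have [I_sub I_mul] := I_ideal; have [B_sub _ _] := B_alg.
move=> Ha i1 jt ijn; apply: subspace_sum => // k; rewrite mem_index_iota => ikj _.
have [gik Iik _] := Ha i k ltac:(lia) ltac:(lia) ltac:(lia) ltac:(lia).
have [gkj Ikj _] := Ha k.+1 j ltac:(lia) ltac:(lia) ltac:(lia) ltac:(lia).
have [ik|] := ltnP i k.
  apply: (I_mul (a k.+1 j) _ _ _).2; last by apply: (subspaceZ _ I_sub); apply: Iik.
  by apply: B_low gkj; apply: mdeg_low; lia.
move=> ki; apply: (I_mul _ (a k.+1 j) _ _).1; last by apply: Ikj; lia.
by apply: (subspaceZ _ B_sub); apply: B_low gik; apply: mdeg_low; lia.
Qed.

(** The pair [(1, t)] is allowed here, so this serves both the induction and the final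
    representative. *)
Lemma massey_sum_exact (a : nat -> nat -> A) (n i j : nat) :
  ideal_system a n -> (1 <= i)%N -> (j <= t)%N -> (1 < j - i <= n.+1)%N ->
  exists2 z, gr (mdeg p i j) z & dif A z = massey_sum p a i j.
Proof.
move=> Ha i1 jt ijn; apply: exact_gr.
  apply: massey_sum_gr => // k ikj; split.
    by have [] := Ha i k ltac:(lia) ltac:(lia) ltac:(lia) ltac:(lia).
  by have [] := Ha k.+1 j ltac:(lia) ltac:(lia) ltac:(lia) ltac:(lia).
apply: I_exact; first exact: massey_sum_ideal _ _ _ _ Ha _ _ _.
apply: massey_sum_closed => // k l ikl lj prop.
by have [] := Ha k l ltac:(lia) ltac:(lia) ltac:(lia) ltac:(lia).
Qed.

(* The entries [a i j] with [i < j] can be moved into [I] without changing the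
   diagonal: for [j = i.+1] by dropping the closed part of [a i j], and then
   because all the longer Massey sums lie in [I]. *)
Lemma ideal_system_exists (a : nat -> nat -> A) (n : nat) :
  (3 <= t)%N ->
  (forall i j, (1 <= i <= j)%N -> (j <= t)%N -> (1 < i)%N || (j < t)%N ->
    gr (mdeg p i j) (a i j) /\ dif A (a i j) = massey_sum p a i j) ->
  exists2 a', ideal_system a' n.+1 & forall i, a' i i = a i i.
Proof.
move=> t3 Ha; elim: n => [|n [a' Ha' a'E]].
  apply: ideal_system_extend => [i j ij jt prop ij0|i j ij jt prop ij1].
    by have [] := Ha i j ij jt prop; split=> //; lia.
  (* Here [j] is [i.+1]: the sum is a product of diagonal entries, not known to lie in [I], and the
     original [a i j] supplies its exactness. *)
  have [ga <-] := Ha i j ij jt prop.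
  by apply: I_primitive => //; apply: mdeg_low.
have [i j ij jt prop ijn|a'' Ha'' a''E] := ideal_system_extend a' _ Ha'.
  have [z gz <-] := massey_sum_exact _ _ i j Ha'
    ltac:(lia) ltac:(lia) ltac:(lia).
  by apply: I_primitive => //; apply: mdeg_low.
by exists a'' => // i; rewrite a''E.
Qed.

End Formality.
End DefiningSystems.

Theorem lemma2p9 (R : realType) (M : manifold R)
    (A : dga R) (rho : forall k : nat, A -> dform M k)
    (s t : nat) (p : nat -> nat) (alpha : forall i : nat, set (dform M (p i))) :
  connected [set: M] ->
  minimal_model rho ->
  s_formal A s ->
  (3 <= t)%N ->
  (forall i : nat, (1 <= i <= t)%N -> (0 < p i)%N /\ HdR (alpha i)) ->
  massey_defined rho t alpha ->
  (\sum_(1 <= i < t) p i <= s + t - 2)%N ->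
  (\sum_(2 <= i < t.+1) p i <= s + t - 2)%N ->
  massey_vanishes rho t alpha.
Proof.
move=> _ _ [V [C [N [[V_sub _ freeV _] VCN dC _ exN]]]] t3 pH [a [ga aa da]] le1 le2.
have p0 i : (1 <= i <= t)%N -> (0 < p i)%N by move=> /pH[].
have proper i j : (1 < i)%N || (j < t)%N -> (i, j) <> (1, t)%N.
  by move=> ij [i1 jt]; move: ij; rewrite i1 jt !ltnn.
(* A proper subinterval lies in that from [2] to [t] or in that from [1] to [t.-1]; the two bounds
   on sums of the [p i] say that these have degree at most [s]. *)
have mdeg_low i j : (1 <= i <= j)%N -> (j <= t)%N -> (1 < i)%N || (j < t)%N ->
    (mdeg p i j <= s)%N.
  move=> ij jt /orP[i2|j1].
    apply: leq_trans (mdeg_le t p p0 2 t i j _ _ _) _; [lia..|].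
    by rewrite /mdeg; lia.
  apply: leq_trans (mdeg_le t p p0 1 t.-1 i j _ _ _) _; [lia..|].
  by rewrite /mdeg prednK; lia.
pose B := subalg_gen (\bigcup_(i in `I_s.+1) V i).
pose I := ideal_gen B (\bigcup_(i in `I_s.+1) N i).
have B_alg : is_subalg B := subalg_genP _.
have I_ideal : is_ideal B I := ideal_genP _ _.
have B_low k x : (k <= s)%N -> gr k x -> B x by apply: free_low_degree.
have I_primitive k x : (k <= s)%N -> gr k x ->
    exists y, [/\ I y, gr k y & dif A y = dif A x].
  move=> ks gx; apply: (ideal_primitive V C N s k x V_sub _ dC (B_low _ _ ks gx) gx).
  by move=> i /VCN[].
(* Taking [n] to be [t] covers every length that occurs. *)
have [|a' Ha' a'E] := ideal_system_exists t p p0 B I s B_alg I_ideal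
  B_low I_primitive exN mdeg_low a t t3.
  move=> i j ij jt prop; split; first by apply: ga => //; apply: proper.
  have [<-|ne] := eqVneq i j; last by apply: da; [lia| |apply: proper].
  by rewrite /massey_sum big_geq //; have [] := aa i ltac:(lia).
have a'P i j : (1 <= i <= j)%N -> (j <= t)%N -> (i, j) <> (1, t)%N ->
    gr (mdeg p i j) (a' i j) /\ dif A (a' i j) = massey_sum p a' i j.
  move=> ij jt ne; have prop : (1 < i)%N || (j < t)%N.
    by apply/negPn/negP => ij1; apply: ne; congr (_, _); lia.
  by have [] := Ha' i j ij jt prop ltac:(lia).
exists a'.
  split=> [i j ij jt ne|i it|i j ij jt ne].
  - by have [] := a'P i j ij jt ne.
  - by rewrite a'E; apply: aa.
  - by have [] := a'P i j ltac:(lia) jt ne.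
(* This is where [3 <= t] enters: the full interval has length [t - 1], greater than one. *)
have [z gz zE] := massey_sum_exact t p p0 B I s B_alg I_ideal B_low
  exN mdeg_low a' _ 1 t Ha' ltac:(lia) ltac:(lia) ltac:(lia).
(* Vanishing is stated as an equality of cosets; translation by the primitive [z] identifies their
   exactness conditions. *)
have ex x : exact_elt (x - massey_sum p a' 1 t) <-> exact_elt (x - 0).
  rewrite subr0; split=> -[y _ yE].
    by exists (y + z) => //; rewrite linearD /= yE zE subrK.
  by exists (y - z) => //; rewrite linearB /= yE zE.
by apply/seteqP; split=> x [gx dx /ex].
Qed.
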